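(* Let $T$ be an oriented triangle and $\rho\in\mathbb R$. Then the triangles $\mathcal C_\rho\bigl(\mathcal C_\rho(T)\bigr)$ and $T$ are directly similar in the ratio $1-\rho+\rho^2$. The triangle $\mathcal C_\infty\bigl(\mathcal C_\infty(T)\bigr)$ is directly congruent to $T$. More precisely, $\mathcal C_\rho\bigl(\mathcal C_\rho(T)\bigr)=(1-\rho+\rho^2)\,T$ and $\mathcal C_\infty\bigl(\mathcal C_\infty(T)\bigr)=T$.
   Context: An oriented triangle is written as the ordered triple $T=(a,b,c)$ of its side lengths taken counterclockwise (positive reals with $|a-b|<c<a+b$); for $l>0$, $l\,T=(la,lb,lc)$. Oriented triangles $(a,b,c)$, $(x,y,z)$ are directly similar if $\frac ax=\frac by=\frac cz$ or $\frac ay=\frac bz=\frac cx$ or $\frac az=\frac bx=\frac cy$; the common ratio is the ratio of similarity of the first to the second, and they are directly congruent if this ratio is $1$. Ceva's operators: for $\rho\in\mathbb R$, $\mathcal C_\rho(a,b,c)=(x_\rho,y_\rho,z_\rho)$ with $x_\rho=\sqrt{\rho a^2+(1-\rho)b^2+\rho(\rho-1)c^2}$, $y_\rho=\sqrt{(1-\rho)a^2+\rho(\rho-1)b^2+\rho c^2}$, $z_\rho=\sqrt{\rho(\rho-1)a^2+\rho b^2+(1-\rho)c^2}$ (again side lengths of an oriented triangle); $\mathcal C_\infty(a,b,c)=(c,b,a)$. *)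

(* Defs.v *)
From mathcomp Require Import all_boot all_order all_algebra.
From mathcomp Require Import reals ring lra.

Set Implicit Arguments.
Unset Strict Implicit.
Unset Printing Implicit Defensive.

Import Order.TTheory GRing.Theory Num.Theory.
Local Open Scope ring_scope.

Definition triangle_sides (R : realType) (a b c : R) : bool :=
  [&& 0 < a, 0 < b, 0 < c & `|a - b| < c < a + b].

(* The validity condition is a boolean, so two oriented triangles are equal
   as soon as their ordered triples of sides are. *)
Record oriented_triangle (R : realType) := OrientedTriangle {
  side1 : R;
  side2 : R;
  side3 : R;
  triangle_sidesP : triangle_sides side1 side2 side3 }.

Lemma oriented_triangle_eq (R : realType) (T T' : oriented_triangle R) :
  side1 T = side1 T' -> side2 T = side2 T' -> side3 T = side3 T' -> T = T'.
Proof.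
case: T T' => a b c h [x y z h'] /= e1 e2 e3.
case: _ / e1 h'; case: _ / e2; case: _ / e3 => h'.
by rewrite (bool_irrelevance h h').
Qed.

Lemma scale_triangle_subproof (R : realType) (l : R) (l_gt0 : 0 < l)
    (T : oriented_triangle R) :
  triangle_sides (l * side1 T) (l * side2 T) (l * side3 T).
Proof.
case: T => a b c /= /and4P[a0 b0 c0 /andP[h1 h2]].
apply/and4P; split; rewrite ?mulr_gt0 //.
by rewrite -mulrBr normrM gtr0_norm // -mulrDr !ltr_pM2l // h1 h2.
Qed.

Definition scale_triangle (R : realType) (l : R) (l_gt0 : 0 < l)
    (T : oriented_triangle R) : oriented_triangle R :=
  OrientedTriangle (scale_triangle_subproof l_gt0 T).

(* T is directly similar to T' and l is the ratio of similarity of T to T'. *)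
Definition directly_similar_in_ratio (R : realType)
    (T T' : oriented_triangle R) (l : R) : Prop :=
  let: OrientedTriangle a b c _ := T in
  let: OrientedTriangle x y z _ := T' in
  [\/ [/\ a / x = l, b / y = l & c / z = l],
      [/\ a / y = l, b / z = l & c / x = l] |
      [/\ a / z = l, b / x = l & c / y = l]].

Definition directly_congruent (R : realType) (T T' : oriented_triangle R) :
  Prop := directly_similar_in_ratio T T' 1.

Definition ceva_side1 (R : realType) (rho a b c : R) : R :=
  Num.sqrt (rho * a ^+ 2 + (1 - rho) * b ^+ 2 + rho * (rho - 1) * c ^+ 2).

Definition ceva_side2 (R : realType) (rho a b c : R) : R :=
  Num.sqrt ((1 - rho) * a ^+ 2 + rho * (rho - 1) * b ^+ 2 + rho * c ^+ 2).

Definition ceva_side3 (R : realType) (rho a b c : R) : R :=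
  Num.sqrt (rho * (rho - 1) * a ^+ 2 + rho * b ^+ 2 + (1 - rho) * c ^+ 2).

Lemma ceva_ratio_gt0 (R : realType) (rho : R) : 0 < 1 - rho + rho ^+ 2.
Proof. by have := sqr_ge0 (rho - 1 / 2); rewrite !expr2; lra. Qed.

(* Sixteen times the squared area, in terms of the squared sides (Heron). *)
Definition heron (R : realType) (A B C : R) : R :=
  (A + B + C) ^+ 2 - 2 * (A ^+ 2 + B ^+ 2 + C ^+ 2).

Lemma triangle_sides_heron (R : realType) (a b c : R) :
  triangle_sides a b c -> 0 < heron (a ^+ 2) (b ^+ 2) (c ^+ 2).
Proof.
move=> /and4P[a0 b0 c0]; rewrite ltr_norml => /andP[/andP[h1 h2] h3].
have -> : heron (a ^+ 2) (b ^+ 2) (c ^+ 2) =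
  (a + b + c) * (a + b - c) * ((c + a - b) * (c - a + b)).
  by rewrite /heron; ring.
by rewrite !mulr_gt0 //; lra.
Qed.

Lemma heron_triangle_sides (R : realType) (a b c : R) :
  0 < a -> 0 < b -> 0 < c -> 0 < heron (a ^+ 2) (b ^+ 2) (c ^+ 2) ->
  triangle_sides a b c.
Proof.
move=> a0 b0 c0.
have -> : heron (a ^+ 2) (b ^+ 2) (c ^+ 2) =
  ((a + b) ^+ 2 - c ^+ 2) * (c ^+ 2 - (a - b) ^+ 2) by rewrite /heron; ring.
move=> h.
have lt0 : (a - b) ^+ 2 < (a + b) ^+ 2.
  by rewrite -subr_gt0 (_ : _ - _ = 4 * (a * b)); [rewrite !mulr_gt0|ring].
have lt1 : c ^+ 2 < (a + b) ^+ 2.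
  rewrite ltNge; apply/negP => le1; move: h; rewrite ltNge.
  by rewrite mulr_le0_ge0 // ?subr_le0 // subr_ge0 (le_trans (ltW lt0)).
have lt2 : (a - b) ^+ 2 < c ^+ 2.
  by move: h; rewrite pmulr_rgt0 subr_gt0.
have lt_sqr (x y : R) : 0 < y -> x ^+ 2 < y ^+ 2 -> x < y.
  move=> y0; rewrite !expr2 => + ; rewrite (ltNge x y); apply: contraL => yx.
  by rewrite -leNgt; apply: ler_pM => //; exact: ltW.
apply/and4P; split=> //; apply/andP; split.
  by apply: lt_sqr => //; rewrite real_normK ?num_real.
by apply: lt_sqr => //; rewrite addr_gt0.
Qed.

(* Each squared side of C_rho(T) is a quadratic polynomial in rho whose
   discriminant is the opposite of the Heron expression. *)
Lemma ceva_radicand_gt0 (R : realType) (rho A B C : R) :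
  0 < C -> 0 < heron A B C ->
  0 < rho * A + (1 - rho) * B + rho * (rho - 1) * C.
Proof.
move=> C0 h; have C4 : 0 < 4 * C by rewrite mulr_gt0.
rewrite -(pmulr_rgt0 _ C4).
have -> : 4 * C * (rho * A + (1 - rho) * B + rho * (rho - 1) * C) =
  (2 * C * rho + (A - B - C)) ^+ 2 + heron A B C by rewrite /heron; ring.
by rewrite ltr_wpDl ?sqr_ge0.
Qed.

Lemma ceva_subproof (R : realType) (rho : R) (T : oriented_triangle R) :
  triangle_sides (ceva_side1 rho (side1 T) (side2 T) (side3 T))
                 (ceva_side2 rho (side1 T) (side2 T) (side3 T))
                 (ceva_side3 rho (side1 T) (side2 T) (side3 T)).
Proof.
case: T => a b c /= h; have h0 := triangle_sides_heron h.
case/and4P: h => a0 b0 c0 _; rewrite /ceva_side1 /ceva_side2 /ceva_side3.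
have sq0 (x : R) : 0 < x -> 0 < x ^+ 2 by move=> x0; rewrite exprn_gt0.
move: (sq0 _ a0) (sq0 _ b0) (sq0 _ c0) h0.
set A := a ^+ 2; set B := b ^+ 2; set C := c ^+ 2 => A0 B0 C0 h0.
have h1 := ceva_radicand_gt0 rho C0 h0.
have h2 : 0 < (1 - rho) * A + rho * (rho - 1) * B + rho * C.
  have := @ceva_radicand_gt0 R rho C A B B0.
  rewrite (_ : heron C A B = heron A B C); last by rewrite /heron; ring.
  by move=> /(_ h0); lra.
have h3 : 0 < rho * (rho - 1) * A + rho * B + (1 - rho) * C.
  have := @ceva_radicand_gt0 R rho B C A A0.
  rewrite (_ : heron B C A = heron A B C); last by rewrite /heron; ring.
  by move=> /(_ h0); lra.
apply: heron_triangle_sides; rewrite ?sqrtr_gt0 // !sqr_sqrtr ?ltW //.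
set H := heron _ _ _.
have -> : H = (1 - rho + rho ^+ 2) ^+ 2 * heron A B C.
  by rewrite /H /heron; ring.
by rewrite mulr_gt0 // exprn_gt0 // ceva_ratio_gt0.
Qed.

Definition ceva (R : realType) (rho : R) (T : oriented_triangle R) :
    oriented_triangle R :=
  OrientedTriangle (ceva_subproof rho T).

Lemma ceva_infty_subproof (R : realType) (T : oriented_triangle R) :
  triangle_sides (side3 T) (side2 T) (side1 T).
Proof.
case: T => a b c /= /and4P[a0 b0 c0]; rewrite ltr_norml.
move=> /andP[/andP[h1 h2] h3]; apply/and4P; split => //.
by rewrite ltr_norml; apply/andP; split; [apply/andP; split|]; lra.
Qed.

Definition ceva_infty (R : realType) (T : oriented_triangle R) :
    oriented_triangle R :=
  OrientedTriangle (ceva_infty_subproof T).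

(* Main.v *)
Require Import Defs.
From mathcomp Require Import all_boot all_order all_algebra.
From mathcomp Require Import reals.
From mathcomp Require Import ring.

Import Order.TTheory GRing.Theory Num.Theory.
Local Open Scope ring_scope.

(** On the squared sides (A, B, C), Ceva's operator of parameter rho acts as the
    symmetric matrix M with rows (rho, 1 - rho, s), (1 - rho, s, rho),
    (s, rho, 1 - rho), where s = rho (rho - 1).  The inner product of any two
    distinct rows is rho (1 - rho) + (1 - rho) s + rho s = rho (1 - rho) + s = 0,
    and each row has squared norm rho^2 + (1 - rho)^2 + s^2 = (1 + s)^2.  Hence
    M^2 = (1 + s)^2 I, and taking square roots the sides are multiplied by
    1 + s = 1 - rho + rho^2 > 0 ([ceva_ceva]).

    Passing to squares is harmless because the radicands are positive: since
    the images are genuine triangles, their sides, which are square roots, are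
    positive ([ceva_sqr_sides]).  The operator at infinity exchanges two sides
    and is visibly an involution, and both similarity claims follow from the
    equalities of triangles. *)

Lemma sides_gt0 (R : realType) (T : oriented_triangle R) :
  [/\ 0 < side1 T, 0 < side2 T & 0 < side3 T].
Proof. by case: T => a b c /= /and4P[]. Qed.

(** A real square root squares back to its argument only when the latter is
    nonnegative; here this comes for free, as a zero or negative radicand would
    produce a side equal to 0. *)
Lemma ceva_sqr_sides (R : realType) (rho : R) (T : oriented_triangle R) :
  let A := side1 T ^+ 2 in let B := side2 T ^+ 2 in let C := side3 T ^+ 2 in
  [/\ side1 (ceva rho T) ^+ 2 = rho * A + (1 - rho) * B + rho * (rho - 1) * C,
      side2 (ceva rho T) ^+ 2 = (1 - rho) * A + rho * (rho - 1) * B + rho * C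
    & side3 (ceva rho T) ^+ 2 = rho * (rho - 1) * A + rho * B + (1 - rho) * C].
Proof.
have [] := sides_gt0 R (ceva rho T).
rewrite /= /ceva_side1 /ceva_side2 /ceva_side3 !sqrtr_gt0 => h1 h2 h3.
by split; rewrite sqr_sqrtr ?ltW.
Qed.

Lemma ceva_ceva (R : realType) (rho : R) (T : oriented_triangle R) :
  ceva rho (ceva rho T) = scale_triangle (ceva_ratio_gt0 rho) T.
Proof.
have [s1 s2 s3] := ceva_sqr_sides R rho T.
have [a0 b0 c0] := sides_gt0 R T.
(* Each radicand of the second iterate is the square of a scaled side, which
   is the row computation for M^2; the sign of the scaled side removes the
   absolute value. *)
have sqrtE (x r : R) : 0 < x -> r = ((1 - rho + rho ^+ 2) * x) ^+ 2 ->
    Num.sqrt r = (1 - rho + rho ^+ 2) * x.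
  move=> x0 ->; rewrite sqrtr_sqr ger0_norm //.
  by rewrite mulr_ge0 ?ltW // ceva_ratio_gt0.
apply: oriented_triangle_eq; apply: sqrtE => //; rewrite s1 s2 s3; ring.
Qed.

Lemma ceva_infty_involutive (R : realType) : involutive (@ceva_infty R).
Proof. by move=> T; apply: oriented_triangle_eq. Qed.

Lemma scale_directly_similar (R : realType) (l : R) (l_gt0 : 0 < l)
    (T : oriented_triangle R) :
  directly_similar_in_ratio (scale_triangle l_gt0 T) T l.
Proof.
have [] := sides_gt0 R T; case: T => a b c h /= a0 b0 c0.
by constructor 1; split; rewrite mulfK ?gt_eqF.
Qed.

Lemma directly_congruent_refl (R : realType) (T : oriented_triangle R) :
  directly_congruent T T.
Proof.
have [] := sides_gt0 R T; case: T => a b c h /= a0 b0 c0.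
by constructor 1; split; rewrite divff ?gt_eqF.
Qed.

Theorem proposition9p2 (R : realType) (T : oriented_triangle R) (rho : R) :
  [/\ directly_similar_in_ratio (ceva rho (ceva rho T)) T (1 - rho + rho ^+ 2),
      directly_congruent (ceva_infty (ceva_infty T)) T,
      ceva rho (ceva rho T) = scale_triangle (ceva_ratio_gt0 rho) T
    & ceva_infty (ceva_infty T) = T].
Proof.
rewrite ceva_ceva ceva_infty_involutive; split=> //.
  exact: scale_directly_similar.
exact: directly_congruent_refl.
Qed.
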